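(* Let $f:[\underline{x},\overline{x}]\to\mathbb{R}$ be concave and $N\ge 3$. Starting from an arbitrary breakpoint set with $N$ breakpoints on $[\underline{x},\overline{x}]$, as the number of iterations tends to infinity the breakpoint sets produced by the SAM-absolute error algorithm converge to the breakpoint set that is optimal for minimizing the maximum absolute error.
   Context: For $u<v$ in $[\underline{x},\overline{x}]$, let $L_{u,v}(x)=f(u)+\frac{f(v)-f(u)}{v-u}(x-u)$ and $E(u,v)=\max_{x\in[u,v]}|f(x)-L_{u,v}(x)|$. For $a<b$, $\varPhi(a,b)$ denotes the optimal value of the interior point $c\in(a,b)$ for the minimal maximum absolute error criterion, i.e. the value of $c\in(a,b)$ minimizing $\max\{E(a,c),E(c,b)\}$. A breakpoint set with $N$ breakpoints on $[\underline{x},\overline{x}]$ is a tuple $(x_1,\dots,x_N)$ with $x_1=\underline{x}$, $x_N=\overline{x}$ and $x_i<x_{i+1}$ for all $i$. It is optimal for minimizing the maximum absolute error if $\max_{1\le i\le N-1}E(x_i,x_{i+1})$ is minimal among all breakpoint sets with $N$ breakpoints on $[\underline{x},\overline{x}]$. One iteration of the SAM-absolute error algorithm (sequential adjusting method) takes the current breakpoint set and, for $i=2,3,\dots,N-1$ in sequence, replaces $x_i$ by $\varPhi(x_{i-1},x_{i+1})$, where $x_{i-1}$ is the already updated value and $x_{i+1}$ the not yet updated one; the endpoints $x_1,x_N$ are never changed. The iteration is repeated indefinitely (stopping tolerance ignored).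
   Formalization: The maxima E and minimizers Φ are assumed to exist; as Φ and the optimal set may be non-unique where f is affine, the iterates approach the set of optimal breakpoint sets, and converge to the optimal one when it is unique, which is proved if Φ is unique. *)

(* Defs.v *)
From HB Require Import structures.
From mathcomp Require Export all_boot all_order all_algebra.
From mathcomp Require Export all_classical all_reals all_analysis.
Set Implicit Arguments.
Unset Strict Implicit.
Unset Printing Implicit Defensive.
Export Order.TTheory GRing.Theory Num.Theory.
Export numFieldNormedType.Exports.
Local Open Scope classical_set_scope.
Local Open Scope ring_scope.

Definition concave_on (R : realType) (xl xu : R) (f : R -> R) : Prop :=
  @convex_function R R^o `[xl, xu] (fun x => - f x).

Definition chord (R : realType) (f : R -> R) (u v x : R) : R :=
  f u + (f v - f u) / (v - u) * (x - u).

Definition chord_errors (R : realType) (f : R -> R) (u v : R) : set R :=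
  [set `|f x - chord f u v x| | x in `[u, v]].

(* A supremum, so that it is a total function of u and v; it is the maximum
   when it belongs to [chord_errors f u v]. *)
Definition chord_error (R : realType) (f : R -> R) (u v : R) : R :=
  sup (chord_errors f u v).

Definition split_error (R : realType) (f : R -> R) (a b c : R) : R :=
  Num.max (chord_error f a c) (chord_error f c b).

Definition optimal_split (R : realType) (f : R -> R) (a b c : R) : Prop :=
  a < c < b /\
  forall c', a < c' < b -> split_error f a b c <= split_error f a b c'.

(* Tuples are indexed from 0: x`_i is the (i+1)-st breakpoint. *)
Definition breakpoint_set (R : realType) (xl xu : R) (N : nat)
    (x : N.-tuple R) : Prop :=
  [/\ x`_0 = xl, x`_N.-1 = xu &
      forall i : nat, (i.+1 < N)%N -> x`_i < x`_i.+1].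

Definition max_error (R : realType) (f : R -> R) (N : nat)
    (x : N.-tuple R) : R :=
  \big[Num.max/0]_(i < N.-1) chord_error f x`_i x`_i.+1.

Definition optimal_breakpoints (R : realType) (f : R -> R) (xl xu : R)
    (N : nat) (x : N.-tuple R) : Prop :=
  breakpoint_set xl xu x /\
  forall y : N.-tuple R, breakpoint_set xl xu y ->
    max_error f x <= max_error f y.

Definition sam_update (R : realType) (Phi : R -> R -> R) (N : nat)
    (x : N.-tuple R) (i : nat) : N.-tuple R :=
  [tuple if (j : nat) == i then Phi x`_i.-1 x`_i.+1 else tnth x j | j < N].

(* The interior positions 1, 2, ..., N - 2 are updated in this order. *)
Definition sam_iteration (R : realType) (Phi : R -> R -> R) (N : nat)
    (x : N.-tuple R) : N.-tuple R :=
  foldl (@sam_update R Phi N) x (iota 1 (N - 2)).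

Definition sam (R : realType) (Phi : R -> R -> R) (N : nat)
    (x0 : N.-tuple R) (k : nat) : N.-tuple R :=
  iter k (@sam_iteration R Phi N) x0.

(* Main.v *)
(* An update at x_i never raises the larger of the two errors around x_i, so the
   maximum error decreases along the iteration to some limit D.  If D > 0, then
   E(a, c) is strictly monotone in c, uniformly where it is about D; hence, when
   all errors are at most D + e' for a tiny e' and one of them is at most D - e,
   the update next to it brings the adjacent error below D as well, and after
   N + 1 sweeps all errors are below D, which is impossible.  So all the errors
   tend to D.  Any two breakpoint sets have a pair of nested intervals with the
   same index, so D is at most the maximum error of every breakpoint set.  A
   cluster point of the iterates has errors at most D; its points may coincide,
   but a small refinement of it is a breakpoint set, and that one is optimal. *)

Require Import Defs.
From mathcomp Require Import ring lra zify.
Set Implicit Arguments.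
Unset Strict Implicit.
Unset Printing Implicit Defensive.
Local Open Scope classical_set_scope.
Local Open Scope ring_scope.

(** * The chord error of a concave function *)

(** Cleared of denominators, so that [u = v] is allowed and the inequality can be passed directly to
    linear arithmetic. *)
Definition concave3 (R : realType) (xl xu : R) (f : R -> R) : Prop :=
  forall u w v : R, xl <= u -> u <= w -> w <= v -> v <= xu ->
    (v - w) * f u + (w - u) * f v <= (v - u) * f w.

Lemma concave_on_concave3 (R : realType) (xl xu : R) (f : R -> R) :
  concave_on xl xu f -> concave3 xl xu f.
Proof.
move=> hf u w v lu uw wv vu.
have [uv|] := ltP u v; last first.
  move=> vu'; have -> : w = u by apply/le_anti; rewrite uw (le_trans wv).
  have -> : v = u by apply/le_anti; rewrite vu' (le_trans uw).
  by rewrite subrr !mul0r addr0.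
have t01 : 0 <= (v - w) / (v - u) <= 1.
  rewrite divr_ge0 ?subr_ge0 ?(ltW uv)//= ler_pdivrMr ?subr_gt0// mul1r.
  by rewrite lerB.
pose t : {i01 R} := Itv01 (proj1 (andP t01)) (proj2 (andP t01)).
have uI : u \in `[xl, xu]%classic by apply/mem_set;
  rewrite /= in_itv/= lu (le_trans uw)// (le_trans wv).
have vI : v \in `[xl, xu]%classic by apply/mem_set;
  rewrite /= in_itv/= vu andbT (le_trans lu)// (le_trans uw).
have := hf t u v uI vI.
rewrite [X in _ <= X]convRE/=.
have -> : conv t (u : convex_lmodType R^o) v = w.
  transitivity ((v - w) / (v - u) * u + (1 - (v - w) / (v - u)) * v) => //.
  by field; rewrite subr_eq0 gt_eqF.
have -> : unstable.onem ((v - w) / (v - u)) = (w - u) / (v - u).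
  by rewrite /unstable.onem; field; rewrite subr_eq0 gt_eqF.
rewrite !mulrN -opprD lerN2 -(ler_pM2r (_ : 0 < v - u)) ?subr_gt0//.
have vu0 : v - u != 0 by rewrite subr_eq0 gt_eqF.
by rewrite mulrDl [X in X + _]mulrAC [X in _ + X]mulrAC !divfK// [f w * _]mulrC.
Qed.

(** The signed error. Concavity makes it nonnegative on [u, v], so it replaces the absolute value in
    E(u, v). *)
Definition gap (R : realType) (f : R -> R) (u v x : R) : R :=
  f x - chord f u v x.

Section ChordError.
Context (R : realType) (f : R -> R) (xl xu : R).
Hypothesis hc : concave3 xl xu f.
Hypothesis hmax : forall u v : R, xl <= u -> u < v -> v <= xu ->
  chord_errors f u v (chord_error f u v).

Lemma gap_mul u v x : u < v ->
  gap f u v x * (v - u) = (v - u) * f x - ((v - x) * f u + (x - u) * f v).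
Proof.
by move=> uv; rewrite /gap /chord; field; rewrite subr_eq0 gt_eqF.
Qed.

Lemma gap_ge0 u v x : xl <= u -> u < v -> v <= xu -> u <= x <= v ->
  0 <= gap f u v x.
Proof.
move=> lu uv vu /andP[ux xv].
rewrite -(pmulr_lge0 _ (_ : 0 < v - u)) ?subr_gt0// gap_mul// subr_ge0.
exact: hc.
Qed.

Lemma gapl u v : gap f u v u = 0.
Proof. by rewrite /gap /chord subrr mulr0 addr0 subrr. Qed.

Lemma gapr u v : u < v -> gap f u v v = 0.
Proof. by move=> uv; rewrite /gap /chord; field; rewrite subr_eq0 gt_eqF. Qed.

(** Left of the midpoint [m], [f] lies below the line through its graph points at [m] and [xu];
    right of [m], below the line through those at [xl] and [m]. Boundedness is what makes the
    supremum [chord_error] an upper bound. *)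
Lemma concave_bounded : exists B, forall x, xl <= x <= xu -> f x <= B.
Proof.
pose m := (xl + xu) / 2.
exists (f m + `|f m - f xl| + `|f m - f xu|) => x /andP[lx xu'].
have d1 : f m - f xl <= `|f m - f xl| by exact: ler_norm.
have d2 : f m - f xu <= `|f m - f xu| by exact: ler_norm.
have e1 : f xl - f m <= `|f m - f xl| by rewrite distrC ler_norm.
have e2 : f xu - f m <= `|f m - f xu| by rewrite distrC ler_norm.
have p1 : 0 <= `|f m - f xl| by [].
have p2 : 0 <= `|f m - f xu| by [].
have [->|xlx] := eqVneq x xl; first by lra.
have [->|xxu] := eqVneq x xu; first by lra.
have {}lx : xl < x by rewrite lt_neqAle eq_sym xlx.
have {}xu' : x < xu by rewrite lt_neqAle xxu.
have mE : m = (xl + xu) / 2 by [].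
have [xm|mx] := leP x m.
- have := hc (ltW lx) xm (_ : m <= xu) (lexx _).
  have h0 : m <= xu by lra.
  move=> /(_ h0) h.
  suff : (xu - m) * f x <= (xu - m) * (f m + `|f m - f xu|).
    rewrite ler_pM2l; last by lra.
    by lra.
  have : (m - x) * (f m - f xu) <= (xu - m) * `|f m - f xu|.
    apply: (@le_trans _ _ ((m - x) * `|f m - f xu|)).
      by apply: ler_wpM2l => //; lra.
    by apply: ler_wpM2r => //; lra.
  by nra.
- have := hc (lexx _) (_ : xl <= m) (ltW mx) (ltW xu').
  have h0 : xl <= m by lra.
  move=> /(_ h0) h.
  suff : (m - xl) * f x <= (m - xl) * (f m + `|f m - f xl|).
    rewrite ler_pM2l; last by lra.
    by lra.
  have : (x - m) * (f m - f xl) <= (m - xl) * `|f m - f xl|.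
    apply: (@le_trans _ _ ((x - m) * `|f m - f xl|)).
      by apply: ler_wpM2l => //; lra.
    by apply: ler_wpM2r => //; lra.
  by nra.
Qed.

Lemma chord_error_ge_gap u v x : xl <= u -> u < v -> v <= xu -> u <= x <= v ->
  gap f u v x <= chord_error f u v.
Proof.
move=> lu uv vu xI; have [B hB] := concave_bounded.
apply: (@le_trans _ _ `|gap f u v x|); first exact: ler_norm.
apply: sup_upper_bound; last first.
  by exists x => //=; rewrite in_itv.
split; first by exists `|gap f u v x|, x => //=; rewrite in_itv.
exists (B + (`|f u| + `|f v|)) => _ [y /= yI <-].
rewrite in_itv/= in yI.
have /andP[uy yv] := yI.
rewrite -/(gap f u v y) ger0_norm ?gap_ge0//.
rewrite -(ler_pM2r (_ : 0 < v - u)) ?subr_gt0// gap_mul//.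
have fy : f y <= B by apply: hB; rewrite (le_trans lu)//= (le_trans yv).
have h1 : - `|f u| <= f u by rewrite lerNl -normrN ler_norm.
have h2 : - `|f v| <= f v by rewrite lerNl -normrN ler_norm.
have p1 : 0 <= `|f u| by [].
have p2 : 0 <= `|f v| by [].
have : (v - u) * f y <= (v - u) * B by rewrite ler_pM2l ?subr_gt0.
have : (v - y) * - `|f u| <= (v - y) * f u by rewrite ler_wpM2l// subr_ge0.
have : (y - u) * - `|f v| <= (y - u) * f v by rewrite ler_wpM2l// subr_ge0.
have : (v - y) * `|f u| <= (v - u) * `|f u| by rewrite ler_wpM2r//; lra.
have : (y - u) * `|f v| <= (v - u) * `|f v| by rewrite ler_wpM2r//; lra.
by lra.
Qed.

Lemma chord_error_attained u v : xl <= u -> u < v -> v <= xu ->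
  exists2 x, u <= x <= v & chord_error f u v = gap f u v x.
Proof.
move=> lu uv vu; have [x /= xI h] := hmax lu uv vu.
rewrite in_itv/= in xI; exists x => //.
by rewrite -h ger0_norm// -/(gap f u v x) gap_ge0.
Qed.

(** For [u = v] the only error is 0; for [v < u] the set is empty and its supremum is 0 by
    convention. Monotonicity and continuity can thus be stated without ordering the end points,
    which helps at cluster points, where breakpoints may coincide. *)
Lemma chord_error_degen u v : v <= u -> chord_error f u v = 0.
Proof.
rewrite /chord_error le_eqVlt => /predU1P[->|vu].
  have -> : chord_errors f u u = [set 0]; last exact: sup1.
  apply/seteqP; split=> [_ [x /= xI <-]|_ ->].
    rewrite in_itv/= in xI.
    have -> : x = u by apply/le_anti; rewrite andbC.
    by rewrite -/(gap f u u u) gapl normr0.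
  exists u; first by rewrite /= in_itv/= lexx.
  by rewrite -/(gap f u u u) gapl normr0.
have -> : chord_errors f u v = set0; last exact: sup0.
apply/seteqP; split=> // _ [x /= xI _].
by move: xI; rewrite in_itv/= => /andP[ux xv];
  have := le_lt_trans (le_trans ux xv) vu; rewrite ltxx.
Qed.

Lemma chord_error_ge0 u v : xl <= u -> v <= xu -> 0 <= chord_error f u v.
Proof.
move=> lu vu; have [vu'|uv] := leP v u; first by rewrite chord_error_degen.
by have [x xI ->] := chord_error_attained lu uv vu; exact: gap_ge0.
Qed.

(* The key inequality of the proof: beyond [c], a concave [f] lies below the
   line through the graph points at the maximizer [x0] and at [c]. *)
Lemma chord_error_extend a c c' : xl <= a -> a < c -> c <= c' -> c' <= xu ->
  exists x0, [/\ a <= x0, x0 <= c, gap f a c x0 = chord_error f a c &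
    chord_error f a c * (1 + (c' - c) * (x0 - a) / (xu - xl) ^+ 2)
      <= chord_error f a c'].
Proof.
move=> la ac cc' cu.
have cu' := le_trans cc' cu.
have ac' := lt_le_trans ac cc'.
have [x0 /andP[ax xc] hx] := chord_error_attained la ac cu'.
exists x0; split=> //.
have E0 := @chord_error_ge0 a c la cu'.
have x0I : a <= x0 <= c' by rewrite ax (le_trans xc).
apply: le_trans (chord_error_ge_gap la ac' cu x0I).
have [/eqP Ez|Enz] := boolP (chord_error f a c == 0).
  by rewrite Ez mul0r gap_ge0.
have {Enz}E0 : 0 < chord_error f a c by rewrite lt_neqAle eq_sym Enz.
have {}xc : x0 < c.
  rewrite lt_neqAle xc andbT; apply/eqP => x0c.
  by move: E0; rewrite hx x0c gapr ?ltxx.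
have W0 : 0 < xu - xl by rewrite subr_gt0 (le_lt_trans la)// (lt_le_trans ac').
rewrite hx in E0 *.
(* Measured from the chord over [a, c], the graph at [c'] is below the line with height
   [gap f a c x0] at [x0] and height 0 at [c]. *)
have key : gap f a c c' * (c - x0) <= - ((c' - c) * gap f a c x0).
  rewrite -(ler_pM2r (_ : 0 < c - a)) ?subr_gt0//.
  rewrite mulrAC gap_mul// mulNr -mulrA gap_mul//.
  have := hc (le_trans la ax) (ltW xc) cc' cu.
  have ca : 0 < c - a by lra.
  move=> h; have := ler_wpM2l (ltW ca) h.
  by lra.
(* Passing to the chord over [a, c'] tilts the chord about [a] by the gap at [c'], which is
   nonpositive. Then [c - x0] and [c' - a] are bounded by [xu - xl]. *)
have -> : gap f a c' x0 = gap f a c x0 - gap f a c c' * (x0 - a) / (c' - a).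
  by rewrite /gap /chord; field; rewrite !subr_eq0 !gt_eqF.
rewrite mulrDr mulr1 lerD2l -mulNr -mulNr.
set g := gap f a c c' in key *; set h := gap f a c x0 in E0 key *.
apply: (@le_trans _ _ (((c' - c) * h / (xu - xl)) * ((x0 - a) / (xu - xl)))).
  rewrite le_eqVlt; apply/orP; left; apply/eqP.
  by field; rewrite gt_eqF.
rewrite -[X in _ <= X]mulrA; apply: ler_pM.
- by apply: divr_ge0; [apply: mulr_ge0; [lra|exact: ltW]|exact: ltW].
- by rewrite divr_ge0 ?(ltW W0)// subr_ge0.
- rewrite ler_pdivrMr//.
  have : (c' - c) * h <= - g * (c - x0) by lra.
  move=> h1; apply: (le_trans h1).
  rewrite ler_wpM2l//; last by lra.
  have : 0 <= - g * (c - x0).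
    by apply: le_trans h1; apply: mulr_ge0; [lra|exact: ltW].
  by rewrite pmulr_lge0// subr_gt0.
- rewrite ler_wpM2l ?subr_ge0// lef_pV2 ?posrE ?subr_gt0//.
  all: by lra.
Qed.

Lemma chord_error_le_r a c c' : xl <= a -> c <= c' -> c' <= xu ->
  chord_error f a c <= chord_error f a c'.
Proof.
move=> la cc' cu; have [ca|ac] := leP c a.
  by rewrite (chord_error_degen ca) chord_error_ge0.
have [x0 [ax xc _]] := chord_error_extend la ac cc' cu.
apply: le_trans; rewrite ler_peMr ?chord_error_ge0 ?(le_trans cc')//.
by rewrite lerDl divr_ge0 ?sqr_ge0// mulr_ge0 ?subr_ge0.
Qed.

(** A positive error is not attained at [a], where the gap vanishes; so [x0 - a] is positive and the
    factor in [chord_error_extend] exceeds 1. *)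
Lemma chord_error_lt_r a c c' : xl <= a -> c < c' -> c' <= xu ->
  0 < chord_error f a c -> chord_error f a c < chord_error f a c'.
Proof.
move=> la cc' cu E0; have [ca|ac] := leP c a.
  by move: E0; rewrite (chord_error_degen ca) ltxx.
have [x0 [ax xc ge]] := chord_error_extend la ac (ltW cc') cu.
apply: lt_le_trans; rewrite ltr_pMr// ltrDl.
have W0 : 0 < xu - xl by lra.
rewrite divr_gt0 ?exprn_gt0// mulr_gt0 ?subr_gt0//.
rewrite lt_neqAle ax andbT; apply/eqP => ax0.
by move: E0; rewrite -ge -ax0 gapl ltxx.
Qed.

(* By concavity [f] drops at least as much over the last [x - a] of [[a, c]]
   as its chord does over any stretch of that length. *)
Lemma gap_le_increments a c x : xl <= a -> a < c -> c <= xu -> a <= x <= c ->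
  gap f a c x <= (f x - f a) + (f (a + c - x) - f c).
Proof.
move=> la ac cu /andP[ax xc].
rewrite -(ler_pM2r (_ : 0 < c - a)) ?subr_gt0// gap_mul//.
have h1 : a <= a + c - x by lra.
have h2 : a + c - x <= c by lra.
by have := hc la h1 h2 cu; lra.
Qed.

End ChordError.

(** * Reflection and continuity at the end points *)

(** The reflection of the line exchanges left and right end points, so that each estimate below is
    proved on one side only. *)
Lemma chord_error_opp (R : realType) (f : R -> R) (u v : R) :
  chord_error (fun x => f (- x)) (- v) (- u) = chord_error f u v.
Proof.
have [vu|uv] := leP v u; first by rewrite !chord_error_degen ?lerN2.
rewrite /chord_error; congr sup.
have chordN x : chord (fun x => f (- x)) (- v) (- u) (- x) = chord f u v x.
  by rewrite /chord !opprK; field; rewrite !subr_eq0 gt_eqF//= lt_eqF.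
apply/seteqP; split=> _ [x /= xI <-]; exists (- x); rewrite /= ?in_itv/=.
- by move: xI; rewrite in_itv/= lerNl lerNr andbC.
- by rewrite -[in RHS](opprK x) chordN opprK.
- by move: xI; rewrite in_itv/= !lerN2 andbC.
- by rewrite chordN opprK.
Qed.

Lemma split_error_opp (R : realType) (f : R -> R) (a b c : R) :
  split_error (fun x => f (- x)) (- b) (- a) c = split_error f a b (- c).
Proof. by rewrite /split_error -{1 2}(opprK c) !chord_error_opp maxC. Qed.

Lemma optimal_split_opp (R : realType) (f : R -> R) (a b c : R) :
  optimal_split f a b c -> optimal_split (fun x => f (- x)) (- b) (- a) (- c).
Proof.
move=> [/andP[ac cb] h]; split; first by rewrite !ltrN2 cb ac.
move=> c' /andP[bc ca]; rewrite !split_error_opp opprK; apply: h.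
by rewrite ltrNr ca ltrNl bc.
Qed.

Lemma concave3_opp (R : realType) (xl xu : R) (f : R -> R) :
  concave3 xl xu f -> concave3 (- xu) (- xl) (fun x => f (- x)).
Proof.
move=> hc u w v lu uw wv vu.
have := hc (- v) (- w) (- u); rewrite lerNr !lerN2 lerNl => /(_ vu wv uw lu).
by lra.
Qed.

(** These assumptions on [f] are stable under reflection. Only the existence of optimal splits is
    kept from [Phi]; it is what forces [f] to be continuous at the end points. *)
Record splittable (R : realType) (xl xu : R) (f : R -> R) : Prop := Splittable {
  splittable_concave : concave3 xl xu f;
  splittable_max : forall u v : R, xl <= u -> u < v -> v <= xu ->
      chord_errors f u v (chord_error f u v);
  splittable_opt : forall a b : R, xl <= a -> a < b -> b <= xu ->
      exists c, optimal_split f a b c }.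

Lemma splittable_opp (R : realType) (xl xu : R) (f : R -> R) :
  splittable xl xu f -> splittable (- xu) (- xl) (fun x => f (- x)).
Proof.
move=> [hc hm ho]; split; first exact: concave3_opp.
- move=> u v lu uv vu.
  have h : chord_errors f (- v) (- u) (chord_error f (- v) (- u)).
    by apply: hm; rewrite 1?lerNr 1?ltrN2 1?lerNl.
  rewrite -(opprK u) -(opprK v) chord_error_opp.
  have [x /= xI e] := h; exists (- x).
    by move: xI; rewrite /= !in_itv/= !lerN2 andbC.
  rewrite -e opprK; congr (`| _ - _ |); first by rewrite opprK.
  rewrite /chord !opprK.
  by field; rewrite ?subr_eq0 ?[- u + v]addrC ?subr_eq0 ?gt_eqF.
- move=> a b la ab bu; have [||| c hopt] := ho (- b) (- a).
  + by rewrite lerNr.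
  + by rewrite ltrN2.
  + by rewrite lerNl.
  by exists (- c); rewrite -(opprK a) -(opprK b); apply: optimal_split_opp.
Qed.

Section EndpointContinuity.
Context (R : realType) (f : R -> R) (xl xu : R).
Hypothesis hf : splittable xl xu f.
Hypothesis lu : xl < xu.
Let hc := splittable_concave hf.
Let hmax := splittable_max hf.

(** The points [w] and [u + z - w] are symmetric about the midpoint of [u, z]; the concavity
    inequalities at the two add up to the claim. *)
Lemma concave_exchange u w z : xl <= u -> u <= w -> w <= z -> z <= xu ->
  f u + f z <= f w + f (u + z - w).
Proof.
move=> xu0 uw wz zu; have [uz|zu'] := ltP u z; last first.
  have -> : w = z by apply/le_anti; rewrite wz (le_trans zu').
  by rewrite addrK addrC.
have h1 := hc xu0 uw wz zu.
have h2 := hc xu0 (_ : u <= u + z - w) (_ : u + z - w <= z) zu.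
have e1 : u <= u + z - w by lra.
have e2 : u + z - w <= z by lra.
move: h2 => /(_ e1 e2) h2.
rewrite -(ler_pM2l (_ : 0 < z - u)) ?subr_gt0//.
by lra.
Qed.

(* [f] plus a suitable linear function is monotone near [xl]. *)
Lemma concave_right_cauchy (e : R) : 0 < e -> exists b, [/\ xl < b, b <= xu &
  forall x y, xl < x <= b -> xl < y <= b -> `|f x - f y| <= e].
Proof.
move=> e0; have lu' := lu; have [B hB] := concave_bounded hc.
pose W := xu - xl; have W0 : 0 < W by rewrite subr_gt0.
pose m := (xl + xu) / 2.
have ml : xl < m by rewrite /m; lra.
have mu : m < xu by rewrite /m; lra.
(* A lower bound for the slope of the chord from any [y <= m] to [xu], since [f y <= B] and
   [xu - y >= W / 2]. Hence [f x - s * x] is nondecreasing up to [m]. *)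
pose s := 2 * (f xu - B) / W.
have sW : s * W = 2 * (f xu - B) by rewrite /s divfK// gt_eqF.
have fuB : f xu <= B by apply: hB; rewrite lexx ltW.
have s0 : s <= 0.
  by rewrite -(pmulr_lle0 _ W0) sW; lra.
have mono x y : xl < x -> x <= y -> y <= m -> f x - s * x <= f y - s * y.
  move=> lx xy ym.
  have h := hc (ltW lx) xy (ltW (le_lt_trans ym mu)) (lexx _).
  have fy : f y <= B by apply: hB;
    rewrite (ltW (lt_le_trans lx xy)) (le_trans ym)// ltW.
  have d : 0 < xu - y by rewrite subr_gt0 (le_lt_trans ym).
  have d2 : W <= 2 * (xu - y) by move: ym; rewrite /W /m; lra.
  have h2 : s * (xu - y) <= f xu - f y.
    have : (xu - y) * - s >= W / 2 * - s by rewrite ler_wpM2r; lra.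
    by lra.
  have h3 : (y - x) * (s * (xu - y)) <= (y - x) * (f xu - f y).
    by rewrite ler_wpM2l// subr_ge0.
  rewrite -(ler_pM2l d); lra.
pose S := [set f x - s * x | x in [set x | xl < x <= m]].
have lbS : has_inf S.
  split; first by exists (f m - s * m), m => //=; rewrite ml lexx.
  exists (- `|f xl| - `|f xu| + s * `|xl|) => _ [x /= /andP[lx xm] <-].
  have h := hc (lexx _) (ltW lx) (le_trans xm (ltW mu)) (lexx _).
  have p1 : 0 <= `|f xl| by [].
  have p2 : 0 <= `|f xu| by [].
  have n1 : - `|f xl| <= f xl by rewrite lerNl -normrN ler_norm.
  have n2 : - `|f xu| <= f xu by rewrite lerNl -normrN ler_norm.
  have sx : s * x <= s * - `|xl|.
    rewrite ler_wnM2l//; have : - `|xl| <= xl by rewrite lerNl -normrN ler_norm.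
    by lra.
  suff : - `|f xl| - `|f xu| <= f x by lra.
  rewrite -(ler_pM2l W0).
  have k1 : (xu - x) * - `|f xl| <= (xu - x) * f xl by rewrite ler_wpM2l; lra.
  have k2 : (x - xl) * - `|f xu| <= (x - xl) * f xu by rewrite ler_wpM2l; lra.
  have k3 : (xu - x) * `|f xl| <= W * `|f xl| by rewrite ler_wpM2r// /W; lra.
  have k4 : (x - xl) * `|f xu| <= W * `|f xu| by rewrite ler_wpM2r// /W; lra.
  by rewrite /W in k3 k4 *; lra.
have e2 : 0 < e / 2 by rewrite divr_gt0.
have [_ [x1 /= /andP[lx1 x1m] <-] hx1] := inf_adherent e2 lbS.
(* Up to [b], the monotone part varies by at most [e / 2], and so does the linear part. The divisor
   [1 - s] stays positive even when [s = 0]. *)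
pose b := Num.min x1 (xl + e / 2 / (1 - s)).
have s1 : 0 < 1 - s by lra.
have bx1 : b <= x1 by rewrite ge_min lexx.
have bl : b - xl <= e / 2 / (1 - s) by rewrite lerBlDl ge_min lexx orbT.
have bl' : (b - xl) * (1 - s) <= e / 2 by rewrite -ler_pdivlMr.
exists b; split.
- by rewrite lt_min lx1 ltrDl !divr_gt0.
- by rewrite (le_trans bx1)// (le_trans x1m)// ltW.
have pin x : xl < x <= b -> inf S <= f x - s * x <= inf S + e / 2.
  move=> /andP[lx xb]; apply/andP; split.
    apply: ge_inf; first by case: lbS.
    by exists x => //=; rewrite lx (le_trans xb)// (le_trans bx1).
  by apply: le_trans (ltW hx1); apply: mono => //; exact: le_trans bx1.
move=> x y xI yI; have /andP[h1 h2] := pin x xI; have /andP[h3 h4] := pin y yI.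
move: xI yI => /andP[lx xb] /andP[ly yb].
have q1 : 0 <= (x - xl) * - s by rewrite mulr_ge0; lra.
have q2 : 0 <= (y - xl) * - s by rewrite mulr_ge0; lra.
have q3 : (x - xl) * - s <= (b - xl) * - s by rewrite ler_wpM2r; lra.
have q4 : (y - xl) * - s <= (b - xl) * - s by rewrite ler_wpM2r; lra.
by rewrite ler_norml; apply/andP; split; lra.
Qed.

(* An upward jump of [f] at [xl] would make E(xl, c) bounded below and strictly
   increasing in [c], while E(c, b) is small for [b] close to [xl]: then the
   split error on [[xl, b]] would have no minimum. *)
Lemma left_end_continuous (e : R) : 0 < e -> exists2 d, 0 < d &
  forall x, xl <= x -> x <= xl + d -> x <= xu -> `|f x - f xl| <= e.
Proof.
move=> e0; have lu' := lu.
have [d1 d10 hd1] : exists2 d, 0 < d &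
    forall x, xl <= x -> x <= xl + d -> x <= xu -> f x <= f xl + e.
  apply: contrapT => nex.
  have jump d : 0 < d -> exists x, [/\ xl < x, x <= xl + d,
    x <= xu & f xl + e < f x].
    move=> d0; apply: contrapT => nx; apply: nex; exists d => // x lx xd xu'.
    rewrite leNgt; apply/negP => fx; apply: nx; exists x; split=> //.
    rewrite lt_neqAle lx andbT; apply/eqP => xlx.
    by move: fx; rewrite -xlx; lra.
  have e4 : 0 < e / 4 by rewrite divr_gt0.
  have [b [lb bu hb]] := concave_right_cauchy e4.
  have [c [/andP[lc cb] hopt]] := splittable_opt hf (lexx _) lb bu.
  pose c' := (xl + c) / 2.
  have lc' : xl < c' by rewrite /c'; lra.
  have c'c : c' < c by rewrite /c'; lra.
  have c'b := lt_trans c'c cb.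
  have c'u : c' <= xu by rewrite (le_trans (ltW c'b)).
  have E1 : e / 2 <= chord_error f xl c'.
    (* At distance at most [(c' - xl) * (e / (2 * k))] from [xl], the chord over [xl, c'] has risen
       by at most [e / 2], while [f] has jumped by more than [e]. *)
    pose k := `|f c' - f xl| + e.
    have k0 : 0 < k by rewrite ltr_wpDl.
    have r1 : e / (2 * k) <= 1.
      rewrite ler_pdivrMr ?mulr_gt0// mul1r /k.
      have : 0 <= `|f c' - f xl| by [].
      by lra.
    have d0 : 0 < (c' - xl) * (e / (2 * k)).
      by rewrite mulr_gt0 ?subr_gt0// divr_gt0// mulr_gt0.
    have [x [lx xd xu' fx]] := jump _ d0.
    have xc' : x <= c'.
      apply: (le_trans xd); rewrite -lerBrDl.
      by rewrite ler_piMr// subr_ge0 ltW.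
    apply: le_trans (chord_error_ge_gap hc (lexx _) lc' c'u
      (_ : xl <= x <= c')).
      2: by rewrite (ltW lx).
    rewrite /gap /chord.
    have : (f c' - f xl) / (c' - xl) * (x - xl) <= e / 2.
      apply: (@le_trans _ _ (k / (c' - xl) * ((c' - xl) * (e / (2 * k)))));
        last first.
        rewrite le_eqVlt; apply/orP; left; apply/eqP; field.
        by rewrite subr_eq0 !gt_eqF.
      apply: (@le_trans _ _ (k / (c' - xl) * (x - xl))).
        rewrite ler_wpM2r//; first by rewrite subr_ge0 ltW.
        rewrite ler_pM2r ?invr_gt0 ?subr_gt0//.
        by rewrite (le_trans (ler_norm _))// lerDl ltW.
      rewrite ler_wpM2l//; last by rewrite lerBlDl.
      by rewrite divr_ge0 ?(ltW k0)// subr_ge0 ltW.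
    by lra.
  have E2 : chord_error f c' b <= e / 4.
    have [x /andP[c'x xb] ->] := chord_error_attained hc hmax (ltW lc') c'b bu.
    rewrite -(ler_pM2r (_ : 0 < b - c')) ?subr_gt0// gap_mul//.
    have xI : xl < x <= b by rewrite xb (lt_le_trans lc').
    have c'I : xl < c' <= b by rewrite lc' ltW.
    have bI : xl < b <= b by rewrite lb lexx.
    have := hb _ _ xI c'I; rewrite ler_norml => /andP[_ h1].
    have := hb _ _ xI bI; rewrite ler_norml => /andP[_ h2].
    have : (b - x) * (f x - f c') <= (b - x) * (e / 4).
      by rewrite ler_wpM2l// subr_ge0.
    have : (x - c') * (f x - f b) <= (x - c') * (e / 4).
      by rewrite ler_wpM2l// subr_ge0.
    by lra.
  have E3 : chord_error f xl c' < chord_error f xl c.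
    by apply: (chord_error_lt_r hc hmax) => //; lra.
  have c'I : xl < c' < b by rewrite lc'.
  have := hopt _ c'I; rewrite leNgt => /negP; apply.
  by rewrite /split_error lt_max gt_max E3/= (le_lt_trans _ E3)//
    (le_trans E2)//; lra.
(* The lower bound comes from concavity alone: [f] stays above its chord over [xl, xu], whose slope
   is at least [- k / W]. *)
pose W := xu - xl; have W0 : 0 < W by rewrite subr_gt0.
pose k := `|f xu - f xl| + 1.
have k0 : 0 < k by rewrite ltr_wpDl.
exists (Num.min d1 (W * e / k)) => [|x lx].
  by rewrite lt_min d10 divr_gt0// mulr_gt0.
rewrite -lerBlDl le_min => /andP[]; rewrite lerBlDl => xd xk xu'.
rewrite ler_norml lerBlDl hd1// andbT.
have h := hc (lexx _) lx xu' (lexx _).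
rewrite ler_pdivlMr// in xk.
rewrite -(ler_pM2l W0).
have : (x - xl) * - k <= (x - xl) * (f xu - f xl).
  rewrite ler_wpM2l ?subr_ge0// lerNl opprB.
  by rewrite (le_trans (ler_norm _))// distrC lerDl.
by rewrite /W in xk *; lra.
Qed.

End EndpointContinuity.

(** * Uniform estimates for the chord error *)

Section LeftEndpoint.
Context (R : realType) (f : R -> R) (xl xu : R).
Hypothesis hf : splittable xl xu f.
Hypothesis lu : xl < xu.
Let hc := splittable_concave hf.
Let hmax := splittable_max hf.

(* Increments of a concave function over a fixed length are largest at the
   left end and smallest at the right end of the interval. *)
Lemma concave_unif_continuous (e : R) : 0 < e -> exists2 d, 0 < d &
  forall x y, xl <= x -> x <= y -> y <= xu -> y - x <= d -> `|f y - f x| <= e.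
Proof.
move=> e0; have lu' := lu.
have [d1 d10 h1] := left_end_continuous hf lu e0.
have lu2 : - xu < - xl by rewrite ltrN2.
have [d2 d20 h2] := left_end_continuous (splittable_opp hf) lu2 e0.
exists (Num.min d1 d2); first by rewrite lt_min d10.
move=> x y lx xy yu; rewrite le_min => /andP[yx1 yx2].
have i1 := concave_exchange hf (lexx xl) lx xy yu.
have i2 := concave_exchange hf lx xy yu (lexx xu).
have := h1 (xl + y - x).
have -> : xl + y - x = xl + (y - x) by lra.
rewrite lerDl subr_ge0 lerD2l => /(_ xy yx1) h1'.
have /h1' : xl + (y - x) <= xu by lra.
rewrite ler_norml => /andP[_ k1].
have := h2 (- (x + xu - y)).
rewrite !opprK => h2'.
have /h2' : - xu <= - (x + xu - y) by lra.
move=> {}h2'.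
have /h2' : - (x + xu - y) <= - xu + d2 by lra.
move=> {}h2'.
have /h2' : - (x + xu - y) <= - xl by lra.
rewrite ler_norml => /andP[_ k2].
have e1 : xl + y - x = xl + (y - x) by lra.
rewrite e1 in i1.
by rewrite ler_norml; apply/andP; split; lra.
Qed.

(** If the maximizer over [c', b] lies in [c', c], its gap is at most the sum of two increments over
    lengths at most [d]. Otherwise its gap exceeds the one for [c, b] by a fraction of the gap at
    [c], which is small for the same reason. *)
Lemma chord_error_cont_l (e : R) : 0 < e -> exists2 d, 0 < d &
  forall c' c b, xl <= c' -> c' <= c -> c <= xu -> b <= xu -> c - c' <= d ->
    chord_error f c' b <= chord_error f c b + e.
Proof.
move=> e0; have e2 : 0 < e / 2 by rewrite divr_gt0.
have [d d0 hd] := concave_unif_continuous e2;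
  exists d => // c' c b lc' c'c cu bu cd.
have lc := le_trans lc' c'c.
have E0 := chord_error_ge0 hc hmax lc bu.
have [bc'|c'b] := leP b c'.
  by rewrite (chord_error_degen _ bc') addr_ge0// ltW.
have [x /andP[c'x xb] ->] := chord_error_attained hc hmax lc' c'b bu.
have small y : c' <= y -> y <= c -> y <= b -> gap f c' b y <= e.
  move=> c'y yc yb.
  apply: le_trans (gap_le_increments hc lc' c'b bu _) _; first by rewrite c'y.
  have yd : y - c' <= d by lra.
  have := hd c' y lc' c'y (le_trans yc cu) yd; rewrite ler_norml => /andP[_ h1].
  have z1 : xl <= c' + b - y by lra.
  have z2 : c' + b - y <= b by lra.
  have zd : b - (c' + b - y) <= d by lra.
  have := hd _ _ z1 z2 bu zd; rewrite ler_norml => /andP[h2 _].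
  by lra.
have [xc|cx] := leP x c; first by apply: (le_trans (small x _ _ _)) => //;
  rewrite lerDr.
have cb : c < b by exact: lt_le_trans xb.
have gc := small c c'c (lexx _) (ltW cb).
have gx := chord_error_ge_gap hc lc cb bu (_ : c <= x <= b).
have {}gx := gx (introT andP (conj (ltW cx) xb)).
have -> : gap f c' b x = gap f c b x + gap f c' b c * ((b - x) / (b - c)).
  by rewrite /gap /chord; field; rewrite !subr_eq0 !gt_eqF.
apply: lerD => //.
have g0 : 0 <= gap f c' b c by apply: (gap_ge0 hc) => //; rewrite c'c ltW.
apply: le_trans gc; rewrite ler_piMr// ler_pdivrMr ?subr_gt0//.
by lra.
Qed.

End LeftEndpoint.

Section RightEndpoint.
Context (R : realType) (f : R -> R) (xl xu : R).
Hypothesis hf : splittable xl xu f.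
Hypothesis lu : xl < xu.
Let hc := splittable_concave hf.
Let hmax := splittable_max hf.

Lemma chord_error_cont_r (e : R) : 0 < e -> exists2 d, 0 < d &
  forall a c c', xl <= a -> xl <= c -> c <= c' -> c' <= xu -> c' - c <= d ->
    chord_error f a c' <= chord_error f a c + e.
Proof.
move=> e0; have lu2 : - xu < - xl by rewrite ltrN2.
have [d d0 hd] := chord_error_cont_l (splittable_opp hf) lu2 e0.
exists d => // a c c' la lc cc' cu cd.
have := hd (- c') (- c) (- a); rewrite !chord_error_opp.
by apply; rewrite ?lerN2//; lra.
Qed.

Lemma chord_error_le_l c c' b : xl <= c' -> c' <= c -> b <= xu ->
  chord_error f c b <= chord_error f c' b.
Proof.
move=> lc' cc' bu; rewrite -(chord_error_opp f c) -(chord_error_opp f c').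
have hf' := splittable_opp hf.
by apply: (chord_error_le_r (splittable_concave hf') (splittable_max hf'));
  rewrite lerN2.
Qed.

Lemma chord_error_sub u v u' v' : xl <= u -> u <= u' -> v' <= v -> v <= xu ->
  chord_error f u' v' <= chord_error f u v.
Proof.
move=> lu0 uu' vv' vu; apply: (@le_trans _ _ (chord_error f u v')).
  by apply: chord_error_le_l => //; rewrite (le_trans vv').
exact: (chord_error_le_r hc hmax).
Qed.

Lemma chord_error_continuous (e : R) : 0 < e -> exists2 d, 0 < d &
  forall u v u' v', xl <= u <= xu -> xl <= v <= xu -> xl <= u' <= xu ->
    xl <= v' <= xu -> `|u - u'| <= d -> `|v - v'| <= d ->
    chord_error f u v <= chord_error f u' v' + e.
Proof.
move=> e0; have e2 : 0 < e / 2 by rewrite divr_gt0.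
have [d1 d10 h1] := chord_error_cont_l hf lu e2.
have [d2 d20 h2] := chord_error_cont_r e2.
exists (Num.min d1 d2); first by rewrite lt_min d10.
move=> u v u' v' /andP[lu0 uu] /andP[lv vu] /andP[lu' uu'] /andP[lv' vu'].
rewrite !le_min => /andP[du _] /andP[_ dv].
apply: (@le_trans _ _ (chord_error f u' v + e / 2)).
  have [uu1|uu1] := leP u u'.
    by apply: h1 => //; rewrite (le_trans _ du)// distrC ler_norm.
  apply: (@le_trans _ _ (chord_error f u' v)); last by rewrite lerDl ltW.
  by apply: chord_error_le_l => //; exact: ltW.
suff : chord_error f u' v <= chord_error f u' v' + e / 2 by lra.
have [vv1|vv1] := leP v' v.
  by apply: h2 => //; rewrite (le_trans _ dv)// ler_norm.
apply: (@le_trans _ _ (chord_error f u' v')); last by rewrite lerDl ltW.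
by apply: (chord_error_le_r hc hmax) => //; exact: ltW.
Qed.

(* If E(a, c) is large, moving [c] to the left by a fixed amount lowers E(a, c)
   by a fixed amount (chord_error_extend), and raises E(c, b) only slightly. *)
Lemma split_drop_l (D e : R) : 0 < D -> 0 < e -> exists2 e', 0 < e' &
  forall a c b, xl <= a -> a < c -> c < b -> b <= xu ->
    chord_error f a c <= D + e' -> chord_error f c b <= D - e ->
    exists2 c', a < c' < b & split_error f a b c' <= D - e'.
Proof.
move=> D0 e0; have lu' := lu.
have e2 : 0 < e / 2 by rewrite divr_gt0.
have D2 : 0 < D / 2 by rewrite divr_gt0.
have D4 : 0 < D / 2 / 2 by rewrite divr_gt0.
have [d d0 hd] := chord_error_cont_l hf lu e2.
have [d1 d10 hd1] := concave_unif_continuous hf lu D4.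
pose W := xu - xl; have W0 : 0 < W by rewrite subr_gt0.
(* The shift of [c]: at most [d], so that E(c - th, b) grows by at most [e / 2], and less than [d1],
   so that [c - th] remains beyond [a]. *)
pose th := Num.min d (d1 / 2).
have th0 : 0 < th by rewrite lt_min d0 divr_gt0.
have thd : th <= d by rewrite ge_min lexx.
have thd1 : th < d1.
  by apply: (@le_lt_trans _ _ (d1 / 2)); [rewrite ge_min lexx orbT | lra].
(* A gap above [D / 2] cannot occur within [d1] of [a], where two increments of at most [D / 4]
   bound it. This bounds the factor [x0 - a] of [chord_error_extend] from below, uniformly. *)
have far a c x : xl <= a -> a < c -> c <= xu -> a <= x <= c ->
    D / 2 < gap f a c x -> d1 < x - a.
  move=> la ac cu /andP[ax xc]; move=> g; rewrite ltNge; apply/negP => xa.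
  move: g; apply/negP; rewrite -leNgt.
  apply: le_trans (gap_le_increments hc la ac cu _) _; first by rewrite ax.
  have z1 : xl <= a + c - x by lra.
  have z2 : a + c - x <= c by lra.
  have zd : c - (a + c - x) <= d1 by lra.
  have := hd1 _ _ z1 z2 cu zd; rewrite ler_norml => /andP[h2 _].
  have := hd1 _ _ la ax (le_trans xc cu) xa; rewrite ler_norml => /andP[_ h1].
  by lra.
(* The guaranteed drop of E(a, c) under the shift. With [e' <= k / 2], it takes an error of at most
   [D + e'] to at most [D - e']. *)
pose k := D / 2 * (th * d1 / W ^+ 2).
have k0 : 0 < k by rewrite mulr_gt0// divr_gt0 ?exprn_gt0// mulr_gt0.
pose e' := Num.min (k / 2) (Num.min (e / 2) (D / 2)).
have e'0 : 0 < e' by rewrite !lt_min e2 D2 divr_gt0.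
have e'k : e' <= k / 2 by rewrite ge_min lexx.
have e'e : e' <= e / 2 by rewrite !ge_min lexx orbT.
have e'D : e' <= D / 2 by rewrite !ge_min lexx !orbT.
exists e' => // a c b la ac cb bu Eac Ecb.
have cu : c <= xu by rewrite (le_trans (ltW cb)).
have [Es|El] := leP (chord_error f a c) (D / 2).
  by exists c; rewrite ?ac// /split_error ge_max; apply/andP; split; lra.
have ac1 : d1 < c - a.
  have [x /andP[ax xc] hx] := chord_error_attained hc hmax la ac cu.
  have : d1 < x - a by apply: (far a c) => //; [rewrite ax | rewrite -hx].
  by lra.
exists (c - th); first by apply/andP; split; lra.
rewrite /split_error ge_max; apply/andP; split; last first.
  have := hd (c - th) c b; have z1 : xl <= c - th by lra.
  have z2 : c - th <= c by lra.
  have z3 : c - (c - th) <= d by lra.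
  by move=> /(_ z1 z2 cu bu z3); lra.
have [Es'|El'] := leP (chord_error f a (c - th)) (D / 2); first by lra.
have z1 : a < c - th by lra.
have z2 : c - th <= c by lra.
have [x0 [ax xc hx ge]] := chord_error_extend hc hmax la z1 z2 cu.
have z3 : c - th <= xu by lra.
have far0 : d1 < x0 - a by apply: (far a (c - th)) => //;
  [rewrite ax | rewrite hx].
set E := chord_error f a (c - th) in ge El' *.
suff : k <= E * ((c - (c - th)) * (x0 - a) / (xu - xl) ^+ 2) by lra.
have -> : c - (c - th) = th by lra.
rewrite /k; apply: ler_pM; rewrite ?(ltW D2) ?(ltW El')//.
  by apply: divr_ge0; [apply: mulr_ge0; exact: ltW | exact: sqr_ge0].
by rewrite ler_pM2r ?invr_gt0 ?exprn_gt0// ler_pM2l// ltW.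
Qed.

End RightEndpoint.

(** * Propagation of small errors *)

(** The optimal split is at least as good as the competitor from [split_drop_l]; when the left error
    is the small one, the competitor comes from the reflected function. *)
Lemma optimal_split_drop (R : realType) (f : R -> R) (xl xu D e : R) :
  splittable xl xu f -> xl < xu -> 0 < D -> 0 < e ->
  exists2 e', 0 < e' <= e &
  forall a c b c', xl <= a -> a < c -> c < b -> b <= xu ->
    optimal_split f a b c' ->
    chord_error f a c <= D + e' -> chord_error f c b <= D + e' ->
    chord_error f a c <= D - e \/ chord_error f c b <= D - e ->
    split_error f a b c' <= D - e'.
Proof.
move=> hf lu D0 e0.
have [e1 e10 h1] := split_drop_l hf lu D0 e0.
have lu2 : - xu < - xl by rewrite ltrN2.
have [e2 e20 h2] := split_drop_l (splittable_opp hf) lu2 D0 e0.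
pose e' := Num.min e (Num.min e1 e2).
have e'e : e' <= e by rewrite ge_min lexx.
have e'1 : e' <= e1 by rewrite !ge_min lexx orbT.
have e'2 : e' <= e2 by rewrite !ge_min lexx !orbT.
exists e'; first by rewrite !lt_min e0 e10 e20.
move=> a c b c' la ac cb bu [_ hopt] Eac Ecb [low|low].
- have := h2 (- b) (- c) (- a); rewrite !chord_error_opp => h2'.
  have [||||||c2 c2I] := h2'; rewrite ?lerN2 ?ltrN2//.
    by lra.
  rewrite split_error_opp => hc2.
  apply: (le_trans (hopt (- c2) _)); last by lra.
  by rewrite ltrNr ltrNl andbC.
- have [|c2 c2I hc2] := h1 a c b la ac cb bu _ low; first by lra.
  by apply: (le_trans (hopt c2 c2I)); lra.
Qed.

Lemma foldl_iotaS (T : Type) (g : T -> nat -> T) (z : T) (n : nat) :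
  foldl g z (iota 1 n.+1) = g (foldl g z (iota 1 n)) n.+1.
Proof. by rewrite -{1}(addn1 n) iotaD foldl_cat. Qed.

(** * Effect of single updates and of whole sweeps on breakpoints and errors *)

Section Dynamics.
Context (R : realType) (f : R -> R) (xl xu : R).
Variable Phi : R -> R -> R.
Hypothesis hPhi : forall a b : R, xl <= a -> a < b -> b <= xu ->
  optimal_split f a b (Phi a b).
Variable N : nat.
Implicit Types x y : N.-tuple R.

Let bp x := breakpoint_set xl xu x.
Let err x j := chord_error f x`_j x`_j.+1.
Lemma breakpoint_mono x i j : bp x -> (i <= j)%N -> (j < N)%N -> x`_i <= x`_j.
Proof.
move=> [_ _ h]; elim: j => [|j IH]; first by rewrite leqn0 => /eqP ->.
rewrite leq_eqVlt => /predU1P[-> //|]; rewrite ltnS => ij jN.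
by rewrite (le_trans (IH ij (ltnW jN)))// ltW// h.
Qed.

Lemma breakpoint_bounds x i : bp x -> (i < N)%N -> xl <= x`_i <= xu.
Proof.
move=> hx iN; have [h0 h1 _] := hx; rewrite -h0 -[X in _ <= _ <= X]h1.
by rewrite !(breakpoint_mono hx)//; lia.
Qed.

Lemma nth_sam_update x i j : (j < N)%N ->
  (sam_update Phi x i)`_j = if j == i then Phi x`_i.-1 x`_i.+1 else x`_j.
Proof.
by move=> jN; rewrite -(tnth_nth 0 _ (Ordinal jN)) tnth_mktuple (tnth_nth 0).
Qed.

Lemma sam_update_split x i : bp x -> (0 < i)%N -> (i.+1 < N)%N ->
  optimal_split f x`_i.-1 x`_i.+1 (sam_update Phi x i)`_i.
Proof.
move=> hx i0 iN; rewrite nth_sam_update ?(ltnW iN)// eqxx.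
have [_ _ hs] := hx.
have /andP[b1 _] : xl <= x`_i.-1 <= xu by apply: breakpoint_bounds => //; lia.
have /andP[_ b2] : xl <= x`_i.+1 <= xu by apply: breakpoint_bounds.
apply: hPhi => //; apply: (@lt_trans _ _ x`_i); last exact: hs.
by have := hs i.-1; rewrite prednK// => /(_ (ltnW iN)).
Qed.

Lemma breakpoint_sam_update x i : bp x -> (0 < i)%N -> (i.+1 < N)%N ->
  bp (sam_update Phi x i).
Proof.
move=> hx i0 iN; have [/andP[s1 s2] _] := sam_update_split hx i0 iN.
have [h0 h1 hs] := hx; split.
- by rewrite nth_sam_update ?ifF//; lia.
- by rewrite nth_sam_update ?ifF//; lia.
move=> j jN; have [ji|ji] := eqVneq j i.
  by rewrite ji; rewrite [X in _ < X]nth_sam_update ?ifF//; lia.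
have [ji1|ji1] := eqVneq j.+1 i.
  rewrite -ji1 in s1 *; move: s1; rewrite /= => s1.
  by rewrite [X in X < _]nth_sam_update ?ifF//; lia.
by rewrite !nth_sam_update ?(negbTE ji) ?(negbTE ji1)//; [exact: hs | lia].
Qed.

Lemma err_sam_update_neq x i j : (0 < i)%N -> (i.+1 < N)%N -> (j.+1 < N)%N ->
  j != i -> j.+1 != i -> err (sam_update Phi x i) j = err x j.
Proof.
move=> i0 iN jN ji ji1.
by rewrite /err !nth_sam_update ?(negbTE ji) ?(negbTE ji1)//; lia.
Qed.

Lemma err_sam_update_split x i j : bp x -> (0 < i)%N -> (i.+1 < N)%N ->
  (j == i) || (j.+1 == i) ->
  err (sam_update Phi x i) j <=
    split_error f x`_i.-1 x`_i.+1 (sam_update Phi x i)`_i.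
Proof.
move=> hx i0 iN /orP[|] /eqP ji; rewrite /err.
- by rewrite ji [X in chord_error f _ X]nth_sam_update// ifF ?le_max ?lexx
    ?orbT//; lia.
- rewrite -ji /= [X in chord_error f X _ <= _]nth_sam_update ?ifF; try lia.
  by rewrite /split_error le_max lexx.
Qed.

(** The old breakpoint is itself a competitor in the optimization that defines the new one. *)
Lemma sam_update_split_le x i : bp x -> (0 < i)%N -> (i.+1 < N)%N ->
  split_error f x`_i.-1 x`_i.+1 (sam_update Phi x i)`_i <=
    Num.max (err x i.-1) (err x i).
Proof.
move=> hx i0 iN; have [_ hopt] := sam_update_split hx i0 iN.
have := hopt x`_i; rewrite /split_error /err prednK//; apply.
have [_ _ hs] := hx; rewrite hs// andbT.
by have := hs i.-1; rewrite prednK// => /(_ (ltnW iN)).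
Qed.

Lemma err_sam_update_le x i K : bp x -> (0 < i)%N -> (i.+1 < N)%N ->
  (forall j, (j.+1 < N)%N -> err x j <= K) ->
  forall j, (j.+1 < N)%N -> err (sam_update Phi x i) j <= K.
Proof.
move=> hx i0 iN hK j jN.
have [hj|] := boolP ((j == i) || (j.+1 == i)).
  apply: (le_trans (err_sam_update_split hx i0 iN hj)).
  apply: (le_trans (sam_update_split_le hx i0 iN)).
  by rewrite ge_max !hK//; lia.
by rewrite negb_or => /andP[ji ji1]; rewrite err_sam_update_neq ?hK.
Qed.

Lemma breakpoint_sam_prefix x n : bp x -> (n <= N - 2)%N ->
  bp (foldl (sam_update Phi (N:=N)) x (iota 1 n)).
Proof.
move=> hx; elim: n => // n IH nN; rewrite foldl_iotaS.
by apply: breakpoint_sam_update; [apply: IH|..]; lia.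
Qed.

Lemma err_sam_prefix_le x n K : bp x -> (n <= N - 2)%N ->
  (forall j, (j.+1 < N)%N -> err x j <= K) ->
  forall j, (j.+1 < N)%N ->
    err (foldl (sam_update Phi (N:=N)) x (iota 1 n)) j <= K.
Proof.
move=> hx; elim: n => // n IH nN hK; rewrite foldl_iotaS.
apply: err_sam_update_le; last by apply: IH => //; lia.
- by apply: breakpoint_sam_prefix => //; lia.
- by lia.
- by lia.
Qed.

Lemma breakpoint_sam x k : bp x -> bp (sam Phi x k).
Proof.
move=> hx; elim: k => // k IH.
exact: breakpoint_sam_prefix.
Qed.

Lemma err_sam_le x k K : bp x -> (forall j, (j.+1 < N)%N -> err x j <= K) ->
  forall j, (j.+1 < N)%N -> err (sam Phi x k) j <= K.
Proof.
move=> hx hK; elim: k => // k IH.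
by apply: err_sam_prefix_le => //; exact: breakpoint_sam.
Qed.

Hypothesis hf : splittable xl xu f.
Hypothesis lu : xl < xu.

(* An error below [D - e] spreads to the neighbouring intervals as they are
   updated: to every interval on its right in one sweep, but only to one
   interval on its left. *)
Lemma sam_prefix_spread (D e : R) n : 0 < D -> 0 < e -> (n <= N - 2)%N ->
  exists2 e', 0 < e' <= e & forall x p, bp x ->
    (forall j, (j.+1 < N)%N -> err x j <= D + e') ->
    (p.+1 < N)%N -> err x p <= D - e ->
    forall j, (j.+1 < N)%N ->
      (j == p) || [&& p <= n, p.-1 <= j & j <= n]%N ->
      err (foldl (sam_update Phi (N:=N)) x (iota 1 n)) j <= D - e'.
Proof.
move=> D0 e0; elim: n => [_|n IH nN].
  exists e; first by rewrite e0 lexx.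
  move=> x p hx hK pN low j jN /=; rewrite !leqn0.
  by move=> /orP[/eqP -> //|/and3P[/eqP p0 _ /eqP j0]]; rewrite j0 -p0.
have [|e1 /andP[e10 e1e] h1] := IH; first by lia.
have [e2 /andP[e20 e21] h2] := optimal_split_drop hf lu D0 e10.
exists e2; first by rewrite e20 (le_trans e21).
move=> x p hx hK pN low j jN hj.
rewrite foldl_iotaS.
set y := foldl _ _ _.
have hy : bp y by apply: breakpoint_sam_prefix => //; lia.
have hyK i : (i.+1 < N)%N -> err y i <= D + e2.
  by apply: err_sam_prefix_le => //; lia.
have lowy i : (i.+1 < N)%N -> (i == p) || [&& p <= n, p.-1 <= i & i <= n]%N ->
    err y i <= D - e1.
  move=> iN hi; apply: (h1 x p) => // k kN.
  by apply: (le_trans (hK k kN)); rewrite lerD2l.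
have i0 : (0 < n.+1)%N by [].
have iN : (n.+2 < N)%N by lia.
have [hj'|] := boolP ((j == n.+1) || (j.+1 == n.+1)).
  apply: (le_trans (err_sam_update_split hy i0 iN hj')) => /=.
  have [_ _ hs] := hy.
  have /andP[b1 _] : xl <= y`_n <= xu by apply: breakpoint_bounds => //; lia.
  have /andP[_ b2] : xl <= y`_n.+2 <= xu by apply: breakpoint_bounds.
  apply: (h2 _ y`_n.+1) => //.
  - by apply: hs; lia.
  - exact: hs.
  - exact: (sam_update_split hy i0 iN).
  - by apply: hyK; lia.
  - exact: hyK.
  (* One of the two intervals around point [n.+1] is low: interval [n], reached by the spread, if
     [p <= n]; otherwise [hj] and [hj'] force [p = n.+1], an interval still untouched. *)
  - have [pn|pn] := leqP p n.
      by left; apply: lowy; lia.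
    by right; apply: lowy; lia.
rewrite negb_or => /andP[ji ji1]; rewrite err_sam_update_neq//.
apply: (@le_trans _ _ (D - e1)); last by rewrite lerB.
by apply: lowy => //; lia.
Qed.

(** Each sweep carries the low error one interval to the left; truncated subtraction keeps it at
    interval 0 once there. *)
Lemma sam_spread_left (D e : R) m : 0 < D -> 0 < e ->
  exists2 e', 0 < e' <= e & forall x p, bp x ->
    (forall j, (j.+1 < N)%N -> err x j <= D + e') ->
    (p.+1 < N)%N -> err x p <= D - e ->
    err (sam Phi x m) (p - m) <= D - e'.
Proof.
move=> D0 e0; elim: m => [|m [e1 /andP[e10 e1e] h1]].
  by exists e; [rewrite e0 lexx | move=> x p; rewrite subn0].
have [e2 /andP[e20 e21] h2] := sam_prefix_spread D0 e10 (leqnn (N - 2)).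
exists e2; first by rewrite e20 (le_trans e21).
move=> x p hx hK pN low.
apply: (h2 (sam Phi x m) (p - m)%N); try by lia.
- exact: breakpoint_sam.
- exact: err_sam_le.
- apply: h1 => // j jN; apply: (le_trans (hK j jN)).
  by rewrite lerD2l.
Qed.

(** [N] sweeps bring the low error to interval 0, and one more carries it to the right through all
    intervals. *)
Lemma sam_spread (D e : R) : 0 < D -> 0 < e ->
  exists2 e', 0 < e' & forall x p, bp x ->
    (forall j, (j.+1 < N)%N -> err x j <= D + e') ->
    (p.+1 < N)%N -> err x p <= D - e ->
    forall j, (j.+1 < N)%N -> err (sam Phi x N.+1) j <= D - e'.
Proof.
move=> D0 e0; have [e1 /andP[e10 e1e] h1] := sam_spread_left N D0 e0.
have [e2 /andP[e20 e21] h2] := sam_prefix_spread D0 e10 (leqnn (N - 2)).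
exists e2 => // x p hx hK pN low j jN.
apply: (h2 (sam Phi x N) 0%N); try by lia.
- exact: breakpoint_sam.
- exact: err_sam_le.
- have -> : 0%N = (p - N)%N by lia.
  apply: h1 => // k kN; apply: (le_trans (hK k kN)).
  by rewrite lerD2l.
Qed.

End Dynamics.

(** * Cluster points *)

Lemma err_le_max_error (R : realType) (f : R -> R) (N : nat) (x : N.-tuple R)
    (j : nat) : (j.+1 < N)%N -> chord_error f x`_j x`_j.+1 <= max_error f x.
Proof.
move=> jN; have jN' : (j < N.-1)%N by lia.
exact: (le_bigmax _ (fun i : 'I_N.-1 =>
  chord_error f x`_i x`_i.+1) (Ordinal jN')).
Qed.

Lemma max_error_le (R : realType) (f : R -> R) (N : nat) (x : N.-tuple R) K :
  0 <= K -> (forall j, (j.+1 < N)%N -> chord_error f x`_j x`_j.+1 <= K) ->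
  max_error f x <= K.
Proof.
move=> K0 hK; apply: bigmax_le => // i _; apply: hK.
by have := ltn_ord i; lia.
Qed.

Lemma max_error_ge0 (R : realType) (f : R -> R) (N : nat) (x : N.-tuple R) :
  0 <= max_error f x.
Proof. exact: bigmax_ge_id. Qed.

(** Take the least [i] with [x_(i+1) <= y_(i+1)]; minimality gives [y_i <= x_i], or [i = 0] and both
    points are [xl]. *)
Lemma breakpoint_interleave (R : realType) (xl xu : R) (N : nat)
    (x y : N.-tuple R) : (1 < N)%N ->
  breakpoint_set xl xu x -> breakpoint_set xl xu y ->
  exists i, [/\ (i.+1 < N)%N, y`_i <= x`_i & x`_i.+1 <= y`_i.+1].
Proof.
move=> N1 [x0 x1 _] [y0 y1 _].
pose P i := (i.+1 < N)%N && (x`_i.+1 <= y`_i.+1).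
have exP : exists i, P i.
  exists N.-2; rewrite /P; have -> : N.-2.+1 = N.-1 by lia.
  by rewrite x1 y1 lexx andbT; lia.
case: (ex_minnP exP) => i /andP[iN xyi] mini; exists i; split=> //.
case: i iN xyi mini => [|i] iN xyi mini; first by rewrite x0 y0.
have [//|/ltW xy] := leP y`_i.+1 x`_i.+1.
by have := mini i; rewrite /P (ltnW iN) xy => /(_ isT); rewrite ltnn.
Qed.

(** Compactness of the box [a, b]^N, applied to the filter of tails restricted to the indices
    satisfying [P]; it is proper because [P] holds infinitely often. *)
Lemma frequently_cluster (R : realType) (N : nat) (a b : R)
    (x : nat -> N.-tuple R) (P : nat -> Prop) :
  (forall k i, a <= tnth (x k) i <= b) ->
  (forall K, exists2 k, (K <= k)%N & P k) ->
  exists z : N.-tuple R, forall d K, 0 < d -> exists k,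
    [/\ (K <= k)%N, P k & forall i, `|tnth (x k) i - tnth z i| < d].
Proof.
move=> xab freq.
pose G := within [set k | P k] \oo.
have PG : ProperFilter G.
  apply: Build_ProperFilter_ex => A [K _ hK].
  by have [k Kk Pk] := freq K; exists k; exact: hK.
pose u k : 'rV[R]_N := \row_i tnth (x k) i.
pose C := [set v : 'rV[R]_N | forall i, `[a, b]%classic (v ord0 i)].
have cC : compact C by apply: (@rV_compact _ _ (fun=> `[a, b]%classic)) => i;
  exact: segment_compact.
have FC : (u @ G) C.
  by exists 0%N => // k _ _ i /=; rewrite mxE in_itv/= xab.
have [z [_ clz]] := cC _ (fmap_proper_filter u PG) FC.
exists [tuple z ord0 i | i < N] => d K d0.
have A1 : (u @ G) [set v | exists k, [/\ (K <= k)%N, P k & v = u k]].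
  by exists K => // k /= Kk Pk; exists k.
have A2 : nbhs z [set v : 'rV[R]_N | forall i, `|v ord0 i - z ord0 i| < d].
  apply/nbhs_ballP; exists d => //= v [zv1 zv2] i.
  by rewrite distrC; exact: zv2.
have [v [[k [Kk Pk ->]] hv]] := clz _ _ A1 A2.
exists k; split=> // i; rewrite tnth_mktuple.
by have := hv i; rewrite mxE.
Qed.

(* Repeated points of [z] are spread to the right by multiples of a step so
   small that no other point of [z] is passed, and the points that would pass
   [xu] are spread to its left. *)
Lemma breakpoint_refine (R : realType) (xl xu : R) (N : nat) (z : N.-tuple R)
    (e : R) : (1 < N)%N -> xl < xu -> 0 < e ->
  z`_0 = xl -> z`_N.-1 = xu ->
  (forall i, (i.+1 < N)%N -> z`_i <= z`_i.+1) ->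
  exists y : N.-tuple R, [/\ breakpoint_set xl xu y,
    forall i, (i < N)%N -> `|y`_i - z`_i| <= e &
    forall i, (i.+1 < N)%N -> exists j,
      [/\ (j.+1 < N)%N, z`_j <= y`_i & y`_i.+1 <= z`_j.+1]].
Proof.
move=> N1 lu e0 z0 z1 zS.
have zmono i j : (i <= j)%N -> (j < N)%N -> z`_i <= z`_j.
  elim: j => [|j IH]; first by rewrite leqn0 => /eqP ->.
  rewrite leq_eqVlt => /predU1P[-> //|]; rewrite ltnS => ij jN.
  by rewrite (le_trans (IH ij (ltnW jN)))// zS.
(* The least positive distance between points of [z], capped at [e]. *)
pose g := \big[Num.min/e]_(i < N) \big[Num.min/e]_(j < N)
  (if z`_i < z`_j then z`_j - z`_i else e).
have g0 : 0 < g.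
  apply: lt_bigmin => // i _; apply: lt_bigmin => // j _.
  by case: ifP => // zij; rewrite subr_gt0.
have ge : g <= e by exact: bigmin_le_id.
have gz i j : (i < N)%N -> (j < N)%N -> z`_i < z`_j -> g <= z`_j - z`_i.
  move=> iN jN zij; apply: (bigmin_inf (Ordinal iN)) => //.
  by apply: (bigmin_inf (Ordinal jN)) => //=; rewrite zij.
have N0 : 0 < N%:R :> R by rewrite ltr0n; lia.
pose st := g / N%:R.
have st0 : 0 < st by rewrite divr_gt0.
have stN k : (k <= N)%N -> k%:R * st <= g.
  by move=> kN;
    rewrite /st mulrCA ler_piMr ?(ltW g0)// ler_pdivrMr// mul1r ler_nat.
pose y := fix y (i : nat) : R :=
  if i is i'.+1 then Num.max z`_i (y i' + st) else z`_0.
have yS i : y i.+1 = Num.max z`_i.+1 (y i + st) by [].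
have zy i : z`_i <= y i by case: i => //= i; rewrite le_max lexx.
have yz i : (i < N)%N -> y i <= z`_i + i%:R * st.
  elim: i => [|i IH] iN; first by rewrite mul0r addr0.
  have si : 0 <= i%:R * st by rewrite mulr_ge0 ?ler0n// ltW.
  have := IH (ltnW iN); have := zS i iN.
  rewrite yS -natr1 mulrDl mul1r ge_max => h1 h2.
  by apply/andP; split; lra.
(* The cap leaves one step for each point still to come before [xu]. Being at least [xu - g], it
   does not fall below any point of [z] other than [xu]. *)
pose cap i : R := xu - (N.-1 - i)%:R * st.
have capS i : (i.+1 < N)%N -> cap i.+1 = cap i + st.
  move=> iN; rewrite /cap; have -> : (N.-1 - i)%N = (N.-1 - i.+1).+1 by lia.
  by rewrite -natr1; lra.
have cap_ge i : xu - g <= cap i.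
  by rewrite /cap lerD2l lerN2 stN//; lia.
have cap_le i : cap i <= xu.
  by rewrite /cap gerBl mulr_ge0 ?ler0n// ltW.
pose w i := Num.min (y i) (cap i).
have wS i : (i.+1 < N)%N -> w i < w i.+1.
  move=> iN; rewrite /w capS// yS lt_min; apply/andP; split.
    by rewrite gt_min lt_max ltrDl st0 orbT.
  by rewrite gt_min ltrDl st0 orbT.
have w0 : w 0%N = xl.
  rewrite /w /= z0; apply/min_idPl; apply: le_trans (cap_ge 0%N).
  have := gz 0%N N.-1; rewrite z0 z1 => gz'.
  suff : g <= xu - xl by lra.
  by apply: gz' => //; lia.
have w1 : w N.-1 = xu.
  by rewrite /w /cap subnn mul0r subr0; apply/min_idPr; rewrite -z1.
have zI i : (i < N)%N -> xl <= z`_i <= xu.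
  by move=> iN; rewrite -z0 -[X in _ <= _ <= X]z1 !zmono//; lia.
(* No [z_j] lies strictly between consecutive new points: it would exceed [z_i] by at least [g],
   whereas [y i + st] exceeds [z_i] by at most [i.+1] steps, hence by at most [g]. *)
have skip i j : (i.+1 < N)%N -> (j < N)%N -> w i < z`_j -> w i.+1 <= z`_j.
  move=> iN jN wz; rewrite leNgt; apply/negP => zw.
  have zu : z`_j < xu.
    by apply: (lt_le_trans zw); rewrite /w ge_min cap_le orbT.
  have yzj : y i < z`_j.
    move: wz; rewrite /w gt_min => /orP[//|capz].
    have := gz j N.-1 jN; rewrite z1 => /(_ _ zu).
    have N1' : (N.-1 < N)%N by lia.
    by move=> /(_ N1'); have := cap_ge i; lra.
  have iN' := ltnW iN.
  have zij : z`_i < z`_j := le_lt_trans (zy i) yzj.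
  have gzij := gz _ _ iN' jN zij.
  have ij : (i.+1 <= j)%N.
    by rewrite ltnNge; apply/negP => ji; have := zmono _ _ ji iN'; lra.
  have zyj : z`_j < y i.+1.
    by apply: (lt_le_trans zw); rewrite /w ge_min lexx.
  move: zyj; rewrite yS lt_max => /orP[zz|zyj].
    by have := zmono _ _ ij jN; lra.
  have := yz i iN'; have := stN _ iN'; rewrite -natr1; lra.
have nthw i : (i < N)%N -> [tuple w i | i < N]`_i = w i.
  by move=> iN; rewrite -(tnth_nth 0 _ (Ordinal iN)) tnth_mktuple.
exists [tuple w i | i < N]; split.
- split; first by rewrite nthw ?w0//; lia.
    by rewrite nthw ?w1//; lia.
  by move=> i iN; rewrite !nthw//; [exact: wS | lia].
- move=> i iN; rewrite nthw// ler_norml; apply/andP; split.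
    rewrite lerBrDl /w le_min; have := zy i; have := cap_ge i.
    by have /andP[_ ziu] := zI i iN => h1 h2; apply/andP; split; lra.
  rewrite lerBlDl /w ge_min (le_trans (yz i iN))// lerD2l.
  by rewrite (le_trans (stN _ (ltnW iN))).
- move=> i iN; rewrite !nthw//; last by lia.
  pose P j := (j.+1 < N)%N && (w i < z`_j.+1).
  have exP : exists j, P j.
    exists N.-2; rewrite /P; have -> : N.-2.+1 = N.-1 by lia.
    rewrite z1 (lt_le_trans (wS i iN)) ?andbT; first by lia.
    by rewrite /w ge_min cap_le orbT.
  case: (ex_minnP exP) => j /andP[jN wz] minj; exists j; split=> //.
    case: j jN wz minj => [|j] jN wz minj.
      rewrite z0 -w0; have : (i < N)%N by lia.
      elim: i {iN exP P wz minj} => // i IH iN.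
      by rewrite (le_trans (IH (ltnW iN)))// ltW// wS.
    rewrite leNgt; apply/negP => wz'.
    by have := minj j; rewrite /P wz' (ltnW jN) => /(_ isT); rewrite ltnn.
  exact: skip.
Qed.

(** * Convergence *)

Section Convergence.
Context (R : realType) (f : R -> R) (xl xu : R).
Hypothesis hf : splittable xl xu f.
Hypothesis lu : xl < xu.
Variable Phi : R -> R -> R.
Hypothesis hPhi : forall a b : R, xl <= a -> a < b -> b <= xu ->
  optimal_split f a b (Phi a b).
Variable N : nat.
Hypothesis N1 : (1 < N)%N.
Implicit Types x y : N.-tuple R.

Let hc := splittable_concave hf.
Let hmax := splittable_max hf.

Lemma err_ge0 x j : breakpoint_set xl xu x -> (j.+1 < N)%N ->
  0 <= chord_error f x`_j x`_j.+1.
Proof.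
move=> hx jN; have /andP[l _] := breakpoint_bounds hx (ltnW jN).
by have /andP[_ u] := breakpoint_bounds hx jN; exact: (chord_error_ge0 hc hmax).
Qed.

Lemma sam_errors_cvg x0 : breakpoint_set xl xu x0 ->
  exists2 D, 0 <= D & forall e, 0 < e -> exists K, forall k, (K <= k)%N ->
    forall j, (j.+1 < N)%N ->
      `|chord_error f (sam Phi x0 k)`_j (sam Phi x0 k)`_j.+1 - D| <= e.
Proof.
move=> hx0; pose V k := max_error f (sam Phi x0 k).
have hs k : breakpoint_set xl xu (sam Phi x0 k) by exact: (breakpoint_sam hPhi).
have samD k m : sam Phi x0 (m + k) = sam Phi (sam Phi x0 k) m
  by rewrite /sam iterD.
have Vle k m (B : R) : (forall j, (j.+1 < N)%N ->
    chord_error f (sam Phi x0 k)`_j (sam Phi x0 k)`_j.+1 <= B) ->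
    forall j, (j.+1 < N)%N ->
    chord_error f (sam Phi x0 (m + k))`_j (sam Phi x0 (m + k))`_j.+1 <= B.
  by move=> hB j jN; rewrite samD; exact: (err_sam_le hPhi).
have infV : has_inf (range V).
  split; first by exists (V 0%N), 0%N.
  by exists 0 => _ [k _ <-]; exact: max_error_ge0.
pose D := inf (range V).
have DV k : D <= V k by apply: ge_inf; [case: infV | exists k].
have D0 : 0 <= D.
  by apply: lb_le_inf; [case: infV | move=> _ [k _ <-]; exact: max_error_ge0].
have upper e : 0 < e -> exists K, forall k, (K <= k)%N ->
    forall j, (j.+1 < N)%N ->
      chord_error f (sam Phi x0 k)`_j (sam Phi x0 k)`_j.+1 <= D + e.
  move=> e0; have [_ [K _ <-] hK] := inf_adherent e0 infV.
  exists K => k Kk; rewrite -(subnK Kk); apply: Vle => j jN.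
  by apply: le_trans (ltW hK); exact: err_le_max_error.
exists D => // e e0; have [K1 hK1] := upper e e0.
(* Spreading requires [D > 0]; for [D = 0] the errors are squeezed between 0 and [D + e]. *)
have [Dz|Dnz] := eqVneq D 0.
  exists K1 => k Kk j jN; rewrite ler_norml; apply/andP; split.
    by have := err_ge0 (hs k) jN; lra.
  by have := hK1 k Kk j jN; lra.
have {Dnz}Dpos : 0 < D by rewrite lt_neqAle eq_sym Dnz.
have [e' e'0 spread] := sam_spread hPhi N hf lu Dpos e0.
have [K2 hK2] := upper e' e'0.
exists (maxn K1 K2) => k; rewrite geq_max => /andP[Kk1 Kk2] j jN.
rewrite ler_norml; apply/andP; split; last by have := hK1 k Kk1 j jN; lra.
rewrite lerBrDr addrC leNgt; apply/negP => low.
have := DV (N.+1 + k)%N; rewrite leNgt => /negP; apply.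
have low' := spread _ j (hs k) (hK2 k Kk2) jN (ltW low).
have D' : D - e' < D by lra.
apply: le_lt_trans D'; apply: max_error_le.
  by apply: le_trans (low' j jN); rewrite -samD; apply: err_ge0.
by move=> i iN; rewrite samD; exact: low'.
Qed.

Lemma sam_limit_le_max_error x0 D : breakpoint_set xl xu x0 ->
  (forall e, 0 < e -> exists K, forall k, (K <= k)%N ->
    forall j, (j.+1 < N)%N ->
      `|chord_error f (sam Phi x0 k)`_j (sam Phi x0 k)`_j.+1 - D| <= e) ->
  forall y, breakpoint_set xl xu y -> D <= max_error f y.
Proof.
move=> hx0 hD y hy; apply/ler_addgt0Pr => e e0.
have [K hK] := hD e e0.
have hx : breakpoint_set xl xu (sam Phi x0 K) by exact: (breakpoint_sam hPhi).
have [i [iN yx xy]] := breakpoint_interleave N1 hx hy.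
have := hK K (leqnn K) i iN; rewrite ler_norml => /andP[h _].
have /andP[yl _] := breakpoint_bounds hy (ltnW iN).
have /andP[_ yu] := breakpoint_bounds hy iN.
have := chord_error_sub hf yl yx xy yu.
by have := err_le_max_error f y iN; lra.
Qed.

(** Otherwise infinitely many iterates are far from every optimal set. Let [z] be a cluster point of
    these: its refinement is optimal and within [e / 2] of [z], as is one of the far iterates, a
    contradiction. *)
Lemma sam_near_optimal x0 e : breakpoint_set xl xu x0 -> 0 < e ->
  \forall k \near \oo, exists y, optimal_breakpoints f xl xu y /\
    forall i, `|tnth (sam Phi x0 k) i - tnth y i| < e.
Proof.
move=> hx0 e0; have [D D0 hD] := sam_errors_cvg hx0.
have hopt := sam_limit_le_max_error hx0 hD.
have hs k : breakpoint_set xl xu (sam Phi x0 k) by exact: (breakpoint_sam hPhi).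
pose good k := exists y, optimal_breakpoints f xl xu y /\
    forall i, `|tnth (sam Phi x0 k) i - tnth y i| < e.
apply: contrapT => nev.
have freq K : exists2 k, (K <= k)%N & ~ good k.
  apply: contrapT => nex; apply: nev; exists K => // k /= Kk.
  by apply: contrapT => ng; apply: nex; exists k.
have samI k (i : 'I_N) : xl <= tnth (sam Phi x0 k) i <= xu.
  by rewrite (tnth_nth 0); apply: breakpoint_bounds.
have [z hz] := frequently_cluster samI freq.
have zapp d K : 0 < d -> exists k, [/\ (K <= k)%N, ~ good k &
    forall i, (i < N)%N -> `|(sam Phi x0 k)`_i - z`_i| < d].
  move=> d0; have [k [Kk ng h]] := hz d K d0; exists k; split=> // i iN.
  by rewrite -!(tnth_nth 0 _ (Ordinal iN)).
have zclose (a b : R) : (forall d, 0 < d -> a <= b + d) -> a <= b.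
  by move=> h; apply/ler_addgt0Pr.
have zlim i c : (i < N)%N -> (forall k, (sam Phi x0 k)`_i = c) -> z`_i = c.
  move=> iN hk; apply/eqP; rewrite eq_sym -subr_eq0 -normr_le0.
  apply: zclose => d d0; have [k [_ _ h]] := zapp d 0%N d0.
  by have := h i iN; rewrite hk add0r => /ltW.
have z0 : z`_0 = xl.
  by apply: zlim => [|k]; [lia | case: (hs k)].
have z1 : z`_N.-1 = xu.
  by apply: zlim => [|k]; [lia | case: (hs k)].
have zS i : (i.+1 < N)%N -> z`_i <= z`_i.+1.
  move=> iN; apply: zclose => d d0; have d2 : 0 < d / 2 by rewrite divr_gt0.
  have [k [_ _ h]] := zapp _ 0%N d2.
  have := h i (ltnW iN); rewrite ltr_norml => /andP[h1 h2].
  have := h i.+1 iN; rewrite ltr_norml => /andP[h3 h4].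
  by case: (hs k) => _ _ /(_ i iN) h5; lra.
have zI i : (i < N)%N -> xl <= z`_i <= xu.
  move=> iN; apply/andP; split; apply: zclose => d d0;
    have [k [_ _ h]] := zapp d 0%N d0; have := h i iN;
    have /andP[h1 h2] := breakpoint_bounds (hs k) iN;
    rewrite ltr_norml => /andP[h3 h4]; lra.
have zD j : (j.+1 < N)%N -> chord_error f z`_j z`_j.+1 <= D.
  move=> jN; apply: zclose => d d0; have d2 : 0 < d / 2 by rewrite divr_gt0.
  have [r r0 hr] := chord_error_continuous hf lu d2.
  have [K hK] := hD _ d2.
  have [k [Kk _ h]] := zapp r K r0.
  have := hK k Kk j jN; rewrite ler_norml => /andP[_ h1].
  have jN' := ltnW jN.
  have := hr _ _ _ _ (zI _ jN') (zI _ jN) (breakpoint_bounds (hs k) jN')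
    (breakpoint_bounds (hs k) jN).
  rewrite ![`|z`__ - _|]distrC => /(_ (ltW (h _ jN')) (ltW (h _ jN))).
  by lra.
have e2 : 0 < e / 2 by rewrite divr_gt0.
have [y [hy yz hyz]] := breakpoint_refine N1 lu e2 z0 z1 zS.
have [k [_ ng h]] := zapp _ 0%N e2.
apply: ng; exists y; split.
  split=> // y' /hopt; apply: le_trans.
  apply: max_error_le => // j jN.
  have [i [iN h1 h2]] := hyz j jN.
  apply: le_trans (zD i iN).
  have /andP[l _] := zI i (ltnW iN); have /andP[_ u] := zI _ iN.
  exact: (chord_error_sub hf).
move=> i; rewrite !(tnth_nth 0).
have := h i (ltn_ord i); have := yz i (ltn_ord i).
rewrite ler_norml ltr_norml => /andP[h1 h2] /andP[h3 h4].
by rewrite ltr_norml; apply/andP; split; lra.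
Qed.

(** If one error were smaller, [N.+1] sweeps started from the optimal set itself would strictly
    lower its maximum error. *)
Lemma optimal_errors_equal y : optimal_breakpoints f xl xu y ->
  0 < max_error f y -> forall j, (j.+1 < N)%N ->
    chord_error f y`_j y`_j.+1 = max_error f y.
Proof.
move=> [hy hopt] V0 j jN; apply/le_anti; rewrite err_le_max_error//=.
rewrite leNgt; apply/negP => low.
set D := max_error f y in V0 low hopt.
pose e := D - chord_error f y`_j y`_j.+1.
have e0 : 0 < e by rewrite subr_gt0.
have [e' e'0 spread] := sam_spread hPhi N hf lu V0 e0.
have hyK i : (i.+1 < N)%N -> chord_error f y`_i y`_i.+1 <= D + e'.
  by move=> iN; rewrite (le_trans (err_le_max_error f y iN))// lerDl ltW.
have lowj : chord_error f y`_j y`_j.+1 <= D - e by rewrite /e; lra.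
have low' := spread y j hy hyK jN lowj.
have hs : breakpoint_set xl xu (sam Phi y N.+1) by exact: (breakpoint_sam hPhi).
have := hopt _ hs; rewrite leNgt => /negP; apply.
have D' : D - e' < D by lra.
apply: le_lt_trans D'; apply: max_error_le => //.
by apply: le_trans (low' j jN); exact: err_ge0.
Qed.

(** All errors equal the same positive value, so strict monotonicity of E in its right end point
    determines the breakpoints one by one from the left. *)
Lemma optimal_breakpoints_unique y y' : optimal_breakpoints f xl xu y ->
  0 < max_error f y -> optimal_breakpoints f xl xu y' -> y = y'.
Proof.
move=> hy V0 hy'.
have VV : max_error f y' = max_error f y.
  by apply/le_anti; case: hy hy' => b o [b' o']; rewrite o// o'.
have V0' : 0 < max_error f y' by rewrite VV.
have Ey := optimal_errors_equal hy V0.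
have Ey' := optimal_errors_equal hy' V0'; rewrite VV in Ey'.
have [[b0 _ bS] _] := hy; have [[b0' _ bS'] _] := hy'.
apply: eq_from_tnth => i; rewrite !(tnth_nth 0).
case: i => i /=; elim: i => [|i IH] iN; first by rewrite b0 b0'.
have {}IH := IH (ltnW iN).
have E1 := Ey i iN; have E2 := Ey' i iN; rewrite -IH in E2.
have /andP[l _] := breakpoint_bounds (proj1 hy) (ltnW iN).
have /andP[_ u] := breakpoint_bounds (proj1 hy) iN.
have /andP[_ u'] := breakpoint_bounds (proj1 hy') iN.
have [lt1|lt2|//] := ltgtP y`_i.+1 y'`_i.+1.
- have := chord_error_lt_r hc hmax l lt1 u'.
  by rewrite E1 E2 => /(_ V0); rewrite ltxx.
- have := chord_error_lt_r hc hmax l lt2 u.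
  by rewrite E1 E2 => /(_ V0); rewrite ltxx.
Qed.

(* Where the error vanishes, every interior point is an optimal split. *)
Lemma max_error_gt0 y : breakpoint_set xl xu y ->
  (forall a b c : R, xl <= a -> a < b -> b <= xu ->
    optimal_split f a b c -> c = Phi a b) -> 0 < max_error f y.
Proof.
move=> hy huniq; rewrite lt_neqAle max_error_ge0 andbT; apply/eqP => V0.
have [_ _ hs] := hy; have y01 := hs 0%N N1.
have /andP[l _] := breakpoint_bounds hy (ltnW N1).
have /andP[_ u] := breakpoint_bounds hy N1.
have E0 := err_le_max_error f y N1; rewrite -V0 in E0.
set a := y`_0 in y01 l E0; set b := y`_1 in y01 u E0.
have opt c : a < c < b -> c = Phi a b.
  move=> cI; apply: huniq => //; split=> // c' /andP[ac' c'b].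
  have /andP[ac cb] := cI.
  apply: (@le_trans _ _ 0).
    by rewrite ge_max; apply/andP; split; apply: le_trans E0;
      apply: (chord_error_sub hf) => //; exact: ltW.
  rewrite le_max; apply/orP; left; apply: (chord_error_ge0 hc hmax) => //.
  by rewrite (le_trans (ltW c'b)).
have c1 : a < a + (b - a) / 2 < b by apply/andP; split; lra.
have c2 : a < a + (b - a) / 3 < b by apply/andP; split; lra.
by have := opt _ c1; rewrite -(opt _ c2); lra.
Qed.

End Convergence.

(* [hmax]: the maximum defining E(u, v) exists.
   [hPhi]: Phi a b is an optimal interior point of (a, b).
   Where f is affine, optimal interior points are not unique, and then optimal
   breakpoint sets need not be unique either.  The iterates approach the set of
   all optimal breakpoint sets, they converge to the optimal breakpoint set
   when it is unique, and it is unique when all optimal interior points are. *)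
Theorem mainTheorem3 (R : realType) (f : R -> R) (xl xu : R)
    (hf : concave_on xl xu f)
    (hmax : forall u v : R, xl <= u -> u < v -> v <= xu ->
      chord_errors f u v (chord_error f u v))
    (Phi : R -> R -> R)
    (hPhi : forall a b : R, xl <= a -> a < b -> b <= xu ->
      optimal_split f a b (Phi a b))
    (N : nat) (hN : (3 <= N)%N)
    (x0 : N.-tuple R) (hx0 : breakpoint_set xl xu x0) :
  [/\ forall eps : R, 0 < eps ->
        \forall k \near \oo,
          exists y : N.-tuple R, optimal_breakpoints f xl xu y /\
            forall i : 'I_N, `|tnth (sam Phi x0 k) i - tnth y i| < eps,
      forall y : N.-tuple R, unique (@optimal_breakpoints R f xl xu N) y ->
        forall i : 'I_N,
          (fun k : nat => tnth (sam Phi x0 k) i) @ \oo --> tnth y i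
    & (forall a b c : R, xl <= a -> a < b -> b <= xu ->
        optimal_split f a b c -> c = Phi a b) ->
      exists! y : N.-tuple R, optimal_breakpoints f xl xu y].
Proof.
have N1 : (1 < N)%N := ltnW hN.
have lu : xl < xu.
  have [h0 h1 hs] := hx0; have := hs 0%N N1; rewrite h0 => /lt_le_trans; apply.
  by have /andP[] := breakpoint_bounds hx0 N1.
have hsp : splittable xl xu f.
  split=> //; first exact: concave_on_concave3.
  by move=> a b la ab bu; exists (Phi a b); exact: hPhi.
have near := sam_near_optimal hsp lu hPhi N1 hx0.
split=> [//|y [yopt yuniq] i|huniq].
  apply/cvgrPdistC_lt => e e0; near=> k.
  have [y' [/yuniq <- h]] : exists y', optimal_breakpoints f xl xu y' /\
      forall i : 'I_N, `|tnth (sam Phi x0 k) i - tnth y' i| < e.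
    by near: k; exact: near.
  exact: h.
(* Existence of an optimal set is read off from the first claim: a late iterate is close to one. *)
have [K _ /(_ K (leqnn K)) [y [yopt _]]] := near 1 ltr01.
exists y; split=> // y'.
apply: (optimal_breakpoints_unique hsp lu hPhi) => //.
exact: (max_error_gt0 hsp N1 (proj1 yopt) huniq).
Unshelve. all: by end_near.
Qed.
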